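(* Let $(P,\preceq,\vee)$ be a locally finite join semilattice, $S=\{x_1,x_2,\ldots,x_n\}$ a finite subset of $P$ ordered such that $x_i\preceq x_j$ only if $i\leq j$, $f$ a complex-valued function on $P$, and $d\geq 2$ an integer. Then there exists a tensor-train decomposition, with compression ranks at most $\# S^{\vee\lfloor d/2\rfloor}$, of the $n$-dimensional order $d$ join tensor $[S_d]_f$, given by \[ ([S_d]_f)_{i_1,i_2,\ldots,i_d}=G_1(i_1)G_2(i_2)\cdots G_d(i_d),\qquad i_1,\ldots,i_d\in\{1,\ldots,n\}, \] where the TT-cores are defined by \begin{align*} &G_1(i_1)_{1,\alpha_1}=\delta(x_{i_1},\alpha_1),\\ &G_k(i_k)_{\alpha_{k-1},\alpha_k}=\delta(\alpha_k,x_{i_k}\vee\alpha_{k-1}),\quad k\in\{2,3,\ldots,\lfloor d/2\rfloor\},\\ &G_{\lfloor d/2\rfloor+1}(i_{\lfloor d/2\rfloor+1})_{\alpha_{\lfloor d/2\rfloor},\alpha'_{d-\lfloor d/2\rfloor-1}}=f(\alpha_{\lfloor d/2\rfloor}\vee x_{i_{\lfloor d/2\rfloor+1}}\vee\alpha'_{d-\lfloor d/2\rfloor-1}),\\ &G_k(i_k)_{\alpha_{d-k+1},\alpha_{d-k}}=G_{d-k+1}(i_k)_{\alpha_{d-k},\alpha_{d-k+1}},\quad k\in\{\lfloor d/2\rfloor+2,\ldots,d-1\},\\ &G_d(i_d)_{\alpha_1,1}=G_1(i_d)_{1,\alpha_1}, \end{align*} where each index $\alpha_k$ (or $\alpha'_k$)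 ranges over $S^{\vee k}$ for $k\in\{1,2,\ldots,\lfloor d/2\rfloor\}$. (If $d=2$, the index $\alpha'_{0}$ takes a single dummy value and is omitted from the join, i.e. $G_2(i_2)_{\alpha_1,1}=f(\alpha_1\vee x_{i_2})$, and the last two lines do not apply.)
   Context: A poset $(P,\preceq)$ is locally finite if $\{z\in P\mid x\preceq z\preceq y\}$ is finite for all $x,y\in P$. A join semilattice is a nonempty poset in which any two elements $x,y$ have a least upper bound $x\vee y$. For $S=\{x_1,\ldots,x_n\}\subset P$ and an integer $k\ge 1$, $S^{\vee k}=\{x_{i_1}\vee\cdots\vee x_{i_k}\mid 1\leq i_1\leq\cdots\leq i_k\leq n\}$, and $\#$ denotes cardinality. The order $d$ join tensor on $S$ with respect to $f$ is the $n$-dimensional order $d$ tensor with $([S_d]_f)_{i_1,\ldots,i_d}=f(x_{i_1}\vee\cdots\vee x_{i_d})$, $i_1,\ldots,i_d\in\{1,\ldots,n\}$. $\delta(x,y)=1$ if $x=y$ and $0$ otherwise. A tensor-train decomposition (TT-decomposition) of an $n$-dimensional order $d$ complex tensor $A$ is a representation $A_{i_1,\ldots,i_d}=G_1(i_1)G_2(i_2)\cdots G_d(i_d)$ (matrix products), where for all $i_1,\ldots,i_d\in\{1,\ldots,n\}$ one has $G_1(i_1)\in\mathbb{C}^{1\times r_1}$, $G_k(i_k)\in\mathbb{C}^{r_{k-1}\times r_k}$ for $1<k<d$, and $G_d(i_d)\in\mathbb{C}^{r_{d-1}\times 1}$; the positive integers $r_1,\ldots,r_{d-1}$ are the compression ranks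 and the $G_k$ are the TT-cores. In the claim, rows and columns of the cores are enumerated by elements of the finite sets $S^{\vee k}$: the index summed over between $G_k$ and $G_{k+1}$ ranges over $S^{\vee\min(k,d-k)}$, and indices in different positions of the product are independent summation indices. *)

(* Defs.v *)
From HB Require Import structures.
From mathcomp Require Import all_boot all_order all_algebra.
From mathcomp Require Import finmap complex.
From mathcomp Require Import boolp classical_sets cardinality reals.

Set Implicit Arguments.
Unset Strict Implicit.
Unset Printing Implicit Defensive.

Import Order.TTheory GRing.Theory Num.Theory.

Local Open Scope ring_scope.

Definition locally_finite (disp : Order.disp_t) (P : porderType disp) : Prop :=
  forall a b : P, finite_set [set z : P | (a <= z <= b)%O]%classic.

Section Joins.
Context (disp : Order.disp_t) (P : joinSemilatticeType disp).

(* A join semilattice need not have a bottom, so the empty join is [None]. *)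
Definition joins (s : seq P) : option P :=
  if s is y :: s' then Some (foldl Order.join y s') else None.

Context (n : nat) (x : 'I_n -> P).

(* S^{\vee k} for S = {x_1, ..., x_n} and 1 <= k; it is empty for k = 0. *)
Definition join_set (k : nat) : {fset P} :=
  [fset y in pmap (fun t : k.-tuple 'I_n => joins (map x t))
               [seq t : k.-tuple 'I_n <- enum {: k.-tuple 'I_n}
                         | sorted leq (map val t)]]%fset.

(* The value 0 is only taken in the degenerate case d = 0. *)
Definition join_tensor (C : nzRingType) (f : P -> C) (d : nat)
    (i : d.-tuple 'I_n) : C :=
  oapp f 0 (joins (map x i)).

End Joins.

Arguments join_tensor {disp P n} x {C} f d i.

Section TensorTrain.
Context (C : nzRingType) (n d : nat).

(* Only r_1, ..., r_(d-1) matter; the two outer dimensions are 1. *)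
Definition tt_dim (r : nat -> nat) (k : nat) : nat :=
  if (0 < k < d)%N then r k else 1.

Lemma tt_dim_last r : tt_dim r d = 1%N.
Proof. by rewrite /tt_dim ltnn andbF. Qed.

(* M_1 *m ... *m M_m; the matrix M_0 is never used. *)
Fixpoint tt_prod (D : nat -> nat) (M : forall k, 'M[C]_(D k.-1, D k))
    (m : nat) : 'M[C]_(D 0%N, D m) :=
  if m is m'.+1 then tt_prod M m' *m M m'.+1 else 1%:M.

(* Cores are numbered from 1 and tuple entries from 0, so the k-th index of i
   is [nth i0 i k.-1]; the default i0 is not reached for 1 <= k <= d. *)
Definition tt_decomposition (A : d.-tuple 'I_n -> C) (r : nat -> nat)
    (G : forall k, 'I_n -> 'M[C]_(tt_dim r k.-1, tt_dim r k)) : Prop :=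
  (forall k, (0 < k < d)%N -> (0 < r k)%N) /\
  (forall (i0 : 'I_n) (i : d.-tuple 'I_n),
     A i = tt_prod (fun k => G k (nth i0 i k.-1)) d
             ord0 (cast_ord (esym (tt_dim_last r)) ord0)).

End TensorTrain.

Section JoinTensorTrain.
Context (disp : Order.disp_t) (P : joinSemilatticeType disp).
Context (n : nat) (x : 'I_n -> P) (C : nzRingType) (f : P -> C) (d : nat).

Definition tt_rank (k : nat) : nat := #|` join_set x (minn k (d - k)) |.

(* The a-th element of the set indexing position k between the cores G_k and
   G_(k+1). For k = 0 and k = d the set [join_set x 0] is empty, so the value is
   [None], which plays the role of the single dummy index. *)
Definition tt_index (k a : nat) : option P :=
  onth (join_set x (minn k (d - k))) a.

Definition delta (u v : option P) : C := (u == v)%:R.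

(* Entries of G_k(i) for 1 <= k <= d./2. *)
Definition left_entry (k : nat) (i : 'I_n) (u v : option P) : C :=
  if k == 1%N then delta (Some (x i)) v
  else delta v (omap (Order.join (x i)) u).

(* In the middle core, [pmap id] omits a dummy index from the join; this
   happens only for d = 2. In the last case, k = d gives G_1(i) transposed. *)
Definition tt_entry (k : nat) (i : 'I_n) (u v : option P) : C :=
  if (k <= d./2)%N then left_entry k i u v
  else if k == d./2.+1 then oapp f 0 (joins (pmap id [:: u; Some (x i); v]))
  else left_entry (d - k + 1) i v u.

Definition tt_core (k : nat) (i : 'I_n) :
    'M[C]_(tt_dim d tt_rank k.-1, tt_dim d tt_rank k) :=
  \matrix_(a, b) tt_entry k i (tt_index k.-1 a) (tt_index k b).

End JoinTensorTrain.

(* Main.v *)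
(* Read the train from the left. Up to the middle, the partial product
   G_1 ... G_k is the row vector delta(x_(i_1) v ... v x_(i_k), -): each core
   replaces the selected element by its join with the next x_i. The middle core
   turns this into the row f(x_(i_1) v ... v x_(i_(m+1)) v -), m = floor(d/2),
   and each later core substitutes (x_i v -) for the argument (-), until only
   the dummy index is left. *)

Require Import Defs.
From HB Require Import structures.
From mathcomp Require Import all_boot all_order all_algebra.
From mathcomp Require Import zify.
From mathcomp Require Import finmap complex.
From mathcomp Require Import boolp classical_sets cardinality reals.

Set Implicit Arguments.
Unset Strict Implicit.
Unset Printing Implicit Defensive.

Import Order.TTheory GRing.Theory Num.Theory.

Local Open Scope ring_scope.

Section JoinsTheory.
Context (disp : Order.disp_t) (P : joinSemilatticeType disp).
Implicit Types s : seq P.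

(** A join semilattice may lack a unit for the join; adjoining [None] as unit makes [option P] a
    commutative monoid, so big-operator lemmas apply to [joins]. *)
Local Notation ojoin := (oAC (@joinA _ P) (@joinC _ P)).

Lemma joinsE s : joins s = \big[ojoin/None]_(y <- s) Some y.
Proof.
case: s => [|y s]; first by rewrite big_nil.
rewrite big_cons /=; elim: s y => [|z s IHs] y; first by rewrite big_nil.
by rewrite big_cons /= IHs Monoid.mulmA /= oACE.
Qed.

Lemma perm_joins s (t : seq P) : perm_eq s t -> joins s = joins t.
Proof. by move=> st; rewrite !joinsE (perm_big _ st). Qed.

Lemma joins_pmap (us : seq (option P)) :
  joins (pmap id us) = \big[ojoin/None]_(u <- us) u.
Proof.
rewrite joinsE; elim: us => [|[y|] us IHus] /=; first by rewrite !big_nil.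
  by rewrite !big_cons IHus.
by rewrite big_cons IHus Monoid.mul1m.
Qed.

(** Associativity, with empty blocks dropped. The right side has the shape of the middle core, where
    a dummy index also vanishes under [pmap id]. *)
Lemma joins_flatten (ss : seq (seq P)) :
  joins (flatten ss) = joins (pmap id (map (@joins _ P) ss)).
Proof.
rewrite joins_pmap big_map joinsE big_flatten.
by apply: eq_bigr => s _; rewrite joinsE.
Qed.

Lemma joins_cat s (t : seq P) :
  joins (s ++ t) = joins (pmap id [:: joins s; joins t]).
Proof. by rewrite -[t in LHS]cats0 (joins_flatten [:: s; t]). Qed.

Lemma joins_cons y s :
  s != [::] -> joins (y :: s) = omap (Order.join y) (joins s).
Proof. by case: s => // z s _; rewrite joinsE big_cons -joinsE. Qed.

Section JoinSet.
Context (n : nat) (x : 'I_n -> P).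
Implicit Types (k : nat) (i : 'I_n) (t : seq 'I_n).

(** The join is commutative: sorting an index sequence keeps its join, and the sorted sequence is
    one of those that [join_set] enumerates. *)
Lemma join_setP k (y : P) :
  reflect (exists2 t, size t = k & joins (map x t) = Some y)
          (y \in join_set x k).
Proof.
rewrite in_fset /= mem_pmap; apply: (iffP mapP) => [[t _ ->]|[t tk ty]].
  by exists t; rewrite ?size_tuple.
pose r := relpre val leq : rel 'I_n.
have size_srt : size (sort r t) == k by rewrite size_sort tk.
exists (Tuple size_srt).
  rewrite mem_filter mem_enum andbT /= sorted_map.
  by apply: sort_sorted => a b /=; apply: leq_total.
by rewrite /= -ty; apply/perm_joins/perm_map; rewrite perm_sym perm_sort.
Qed.

Lemma join_set0 : join_set x 0 = fset0.
Proof. by apply/fsetP => y; apply/join_setP; rewrite inE => -[[]]. Qed.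

(** By idempotence an index may be repeated; [0 < k] provides one to repeat. *)
Lemma join_setS k : (0 < k)%N -> {subset join_set x k <= join_set x k.+1}.
Proof.
move=> k_gt0 y /join_setP[[|i t] /= tk ty]; first by rewrite -tk in k_gt0.
apply/join_setP; exists [:: i, i & t]; first by rewrite /= tk.
by rewrite -ty /= joinxx.
Qed.

Lemma join_set_homo k l :
  (0 < k)%N -> (k <= l)%N -> {subset join_set x k <= join_set x l}.
Proof.
move=> k_gt0; elim: l => [|l IHl]; first by rewrite leqNgt k_gt0.
rewrite leq_eqVlt ltnS => /predU1P[-> //|le_kl] y /(IHl le_kl).
by apply: join_setS; apply: leq_trans le_kl.
Qed.

Lemma card_join_set_homo k l :
  (0 < k)%N -> (k <= l)%N -> (#|` join_set x k| <= #|` join_set x l|)%N.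
Proof.
by move=> k_gt0 le_kl; apply/fsubset_leq_card/fsubsetP/join_set_homo.
Qed.

Lemma card_join_set_gt0 k : (0 < n)%N -> (0 < k)%N -> (0 < #|` join_set x k|)%N.
Proof.
move=> n_gt0; case: k => // k _; rewrite cardfs_gt0; apply/fset0Pn.
pose i0 := Ordinal n_gt0.
exists (foldl Order.join (x i0) (map x (nseq k i0))); apply/join_setP.
by exists (nseq k.+1 i0); rewrite ?size_nseq.
Qed.

End JoinSet.
End JoinsTheory.

Section Core.
Context (disp : Order.disp_t) (P : joinSemilatticeType disp).
Context (n d : nat) (x : 'I_n -> P).
Implicit Types (k : nat) (i : 'I_n) (t : seq 'I_n).

Local Notation dim k := (tt_dim d (tt_rank x d) k).
Local Notation idx k a := (tt_index x d k a).

Lemma tt_index_out k a : (0 < k < d)%N = false -> (k <= d)%N ->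
  idx k a = None.
Proof.
move=> k_out le_kd; have min0 : minn k (d - k) = 0%N by lia.
by rewrite /tt_index min0 join_set0 onth0n.
Qed.

(** With [tt_index_inj] and [tt_index_hit]: matrix indices at position k correspond one to one to
    joins of [minn k (d - k)] of the x_i, the dummy at both ends being the empty join. *)
Lemma tt_index_joins k (a : 'I_(dim k)) : (k <= d)%N ->
  exists2 t, size t = minn k (d - k) & idx k a = joins (map x t).
Proof.
move=> le_kd; case k_in: (0 < k < d)%N; last first.
  by exists [::]; rewrite ?tt_index_out //= ; lia.
have : onth (join_set x (minn k (d - k))) a.
  by rewrite onthTE; case: a => a /=; rewrite /tt_dim k_in.
rewrite -/(idx k a); case ay: (idx k a) => [y|] // _.
have /join_setP[t tk ty] : y \in join_set x (minn k (d - k)).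
  by apply/onthP; exists a.
by exists t.
Qed.

Lemma tt_index_inj k (a b : 'I_(dim k)) :
  (k <= d)%N -> idx k a = idx k b -> a = b.
Proof.
move: a b; rewrite /tt_index /tt_dim /tt_rank.
case: ifP => [_|_] a b _; last by rewrite !ord1.
move=> ab; apply/val_inj/eqP => /=.
have [lta ltb] := (ltn_ord a, ltn_ord b).
have [y ay] : exists y, onth (join_set x (minn k (d - k))) a = Some y.
  by move: lta; rewrite /= -onthTE; case: (onth _ _) => // y _; exists y.
rewrite -(nth_uniq y lta ltb) ?fset_uniq //.
by rewrite (onth_nth _ _ _ _ ay) (onth_nth _ _ _ _ (etrans (esym ab) ay)).
Qed.

Lemma tt_index_hit k t : (k <= d)%N -> size t = minn k (d - k) ->
  exists a : 'I_(dim k), idx k a = joins (map x t).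
Proof.
move=> le_kd tk; case k_in: (0 < k < d)%N; last first.
  have dim_gt0 : (0 < dim k)%N by rewrite /tt_dim k_in.
  exists (Ordinal dim_gt0); rewrite tt_index_out //.
  by case: t tk => //= i t; lia.
case ty : (joins (map x t)) => [y|]; last first.
  by case: t tk ty => //= /esym/eqP; lia.
have /onthP[a ay] : y \in join_set x (minn k (d - k)).
  by apply/join_setP; exists t.
have lta : (a < dim k)%N by rewrite /tt_dim k_in /tt_rank -onthTE ay.
by exists (Ordinal lta).
Qed.

Context (C : nzRingType).

(** Every contraction in the train reduces to this: the size of t ensures that its join occurs as an
    index, and injectivity kills all other terms. *)
Lemma sum_tt_index k t (F : option P -> C) :
  (k <= d)%N -> size t = minn k (d - k) ->
  \sum_(a : 'I_(dim k)) delta C (joins (map x t)) (idx k a) * F (idx k a)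
  = F (joins (map x t)).
Proof.
move=> le_kd tk; have [a ta] := tt_index_hit le_kd tk.
rewrite (bigD1 a) //= ta /delta eqxx mul1r big1 ?addr0 // => b neq_ba.
rewrite -ta; case: eqP => [/(tt_index_inj le_kd) ab|_]; last by rewrite mul0r.
by rewrite ab eqxx in neq_ba.
Qed.

(** [omap] would send the dummy [None] to [None], while joining x_i to an empty join must give x_i;
    the separate first case of [left_entry] handles this. *)
Lemma left_entry_joins k i t v : size t = k ->
  left_entry x C k.+1 i (joins (map x t)) v
  = delta C (joins (map x (i :: t))) v.
Proof.
move=> <-; rewrite /left_entry eqSS size_eq0; case: eqP => [->//|/eqP t0].
by rewrite map_cons joins_cons -?size_eq0 ?size_map ?size_eq0 // /delta eq_sym.
Qed.

Context (f : P -> C) (i : d.-tuple 'I_n) (i0 : 'I_n).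

Local Notation T k := (tt_prod (fun m => tt_core x f d m (nth i0 i m.-1)) k).

Lemma tt_prodS k (b : 'I_(dim k.+1)) :
  T k.+1 ord0 b = \sum_(a < dim k) T k ord0 a *
    tt_entry x f d k.+1 (nth i0 i k) (idx k a) (idx k.+1 b).
Proof. by rewrite /= mxE; apply: eq_bigr => a _; rewrite /tt_core mxE. Qed.

Lemma perm_prefix k : (k < d)%N ->
  perm_eq (nth i0 i k :: take k i) (take k.+1 i).
Proof.
by move=> lt_kd; rewrite (take_nth i0) ?size_tuple // perm_sym perm_rcons.
Qed.

Lemma tt_prod_left k (b : 'I_(dim k)) : (k <= d./2)%N ->
  T k ord0 b = delta C (joins (map x (take k i))) (idx k b).
Proof.
elim: k b => [|k IHk] b le_kd2.
  by rewrite /= mxE take0 /= tt_index_out // /delta eqxx (ord1 b).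
have lt_kd : (k < d)%N by lia.
have sz_k : size (take k i) = k by rewrite size_takel // size_tuple ltnW.
rewrite tt_prodS; under eq_bigr => a _.
  rewrite IHk ?(ltnW le_kd2) // /tt_entry le_kd2.
  over.
(* Up to the middle, [minn k (d - k)] is k, the length of the prefix. *)
rewrite (sum_tt_index (fun u => left_entry _ _ _ _ u _)) ?sz_k; try lia.
rewrite left_entry_joins //; congr (delta _ _ _).
by apply/perm_joins/perm_map/perm_prefix.
Qed.

(* The column index is a join of d - k elements, so t stands for the indices
   still to be read. *)
Lemma tt_prod_right k (b : 'I_(dim k)) t :
  (d./2 < k <= d)%N -> size t = (d - k)%N -> idx k b = joins (map x t) ->
  T k ord0 b = oapp f 0 (joins (map x (take k i ++ t))).
Proof.
elim: k b t => [|k IHk] b t; first by rewrite ltn0.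
rewrite ltnS => /andP[le_d2k lt_kd] sz_t bt; rewrite tt_prodS.
have sz_k : size (take k i) = k by rewrite size_takel // size_tuple ltnW.
have join_t : joins (map x (take k i ++ nth i0 i k :: t))
            = joins (map x (take k.+1 i ++ t)).
  by apply/perm_joins/perm_map; rewrite -cat1s catA perm_cat2r cats1
    (take_nth i0) ?size_tuple.
rewrite -join_t bt; move: le_d2k; rewrite leq_eqVlt => /predU1P[kE|lt_d2k].
  (* Core k + 1 is the middle one: the delta row on its left puts the join of the prefix into the
     entry. *)
  under eq_bigr => a _.
    rewrite tt_prod_left ?kE // /tt_entry kE ltnn eqxx.
    over.
  pose F u := oapp f 0 (joins (pmap id
    [:: u; Some (x (nth i0 i k)); joins (map x t)])).
  rewrite (sum_tt_index F) /F ?sz_k; try lia.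
  have := joins_flatten [:: map x (take k i); [:: x (nth i0 i k)]; map x t].
  by rewrite /= cats0 map_cat => ->.
(* Core k + 1 is a transposed left core: now the delta comes from the entry and selects the row
   index. *)
have sz_it : size (nth i0 i k :: t) = (d - k)%N by rewrite /= sz_t; lia.
pose F u := oapp f 0 (joins (pmap id [:: joins (map x (take k i)); u])).
under eq_bigr => a _.
  (* Past the middle, index a is a join of d - k elements, listed by s, so the induction hypothesis
     applies with s. *)
  have [s sz_s as_] := tt_index_joins a (ltnW lt_kd).
  rewrite (IHk _ s) ?lt_d2k ?(ltnW lt_kd) //; last by rewrite sz_s; lia.
  rewrite map_cat joins_cat -as_ /tt_entry.
  rewrite leqNgt ltnS (ltnW lt_d2k) eqSS gtn_eqF //= addn1.
  rewrite left_entry_joins; last lia.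
  (* [C] need not be commutative, but a delta is 0 or 1 and can move to the left. *)
  rewrite -/(F _) /delta commr_nat -/(delta C _ _).
  over.
rewrite (sum_tt_index F) /F ?sz_it; try lia.
by rewrite map_cat joins_cat.
Qed.

End Core.

Theorem theorem3p2 (R : realType) (disp : Order.disp_t)
    (P : joinSemilatticeType disp) (n d : nat) (x : 'I_n -> P) (f : P -> R[i])
    (P_locally_finite : locally_finite P)
    (n_gt0 : (0 < n)%N)
    (x_ordered : forall i j : 'I_n, (x i <= x j)%O -> (i <= j)%N)
    (d_ge2 : (2 <= d)%N) :
  tt_decomposition (join_tensor x f d) (tt_core x f d) /\
  (forall k : nat, (0 < k < d)%N ->
     (tt_rank x d k <= #|` join_set x d./2 |)%N).
Proof.
split; last first.
  (* [minn k (d - k)] lies between 1 and d/2. *)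
  by move=> k k_in; apply: card_join_set_homo; lia.
split=> [k k_in|i0 i].
  by apply: card_join_set_gt0 => //; lia.
(* At k = d nothing is left to read: t is empty and the column index is the dummy. *)
rewrite (@tt_prod_right _ _ n d x _ f i i0 d _ [::]) ?subnn ?leqnn ?andbT //;
  last 1 first.
- by rewrite tt_index_out // ltnn andbF.
- by rewrite cats0 take_oversize ?size_tuple.
- lia.
Qed.
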